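(* For each $n$, suppose $\mathbf{X}\sim\mathbb{P}_{\mathbf{Q},\boldsymbol{\mu}}$ follows the Ising model on $\{\pm1\}^n$ with $\mathbf{Q}=\mathbf{Q}_n$ symmetric and hollow, and consider testing $H_0:\boldsymbol{\mu}=\mathbf{0}$ versus $H_1:\boldsymbol{\mu}\in\Xi(s,B)$, where $s=s_n$ and $B=B_n$ may depend on $n$. Assume that $\mathbf{Q}_{i,j}\ge0$ for all $(i,j)$, that $\|\mathbf{Q}\|_{\ell_\infty\to\ell_\infty}\le\rho<1$ for some constant $\rho>0$, that $\|\mathbf{Q}\|_{\mathrm F}^2=O(\sqrt n)$, and that $$\Big\|\mathbf{Q}\mathbf{1}-\frac{\mathbf{1}^\top\mathbf{Q}\mathbf{1}}{n}\mathbf{1}\Big\|^2=O(1).$$ If $s\tanh(B)\le C\sqrt n$ for some constant $C>0$, then no test is asymptotically powerful for this testing problem.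
   Context: The Ising model with parameters $\mathbf{Q}$ (an $n\times n$ real symmetric matrix which is hollow, i.e. has zero diagonal) and $\boldsymbol{\mu}=(\mu_1,\dots,\mu_n)^\top\in\mathbb{R}^n$ is the probability distribution on $\{\pm1\}^n$ $$\mathbb{P}_{\mathbf{Q},\boldsymbol{\mu}}(\mathbf{X}=\mathbf{x})=\frac{1}{Z(\mathbf{Q},\boldsymbol{\mu})}\exp\Big(\tfrac12\mathbf{x}^\top\mathbf{Q}\mathbf{x}+\boldsymbol{\mu}^\top\mathbf{x}\Big),\qquad \mathbf{x}\in\{\pm1\}^n,$$ where $Z(\mathbf{Q},\boldsymbol{\mu})$ is the normalizing constant. Norms: $\|\mathbf{Q}\|_{\ell_\infty\to\ell_\infty}=\max_{\|x\|_{\ell_\infty}\le1}\|\mathbf{Q}x\|_{\ell_\infty}=\max_{1\le i\le n}\sum_{j=1}^n|\mathbf{Q}_{ij}|$; $\|\mathbf{Q}\|_{\mathrm F}^2=\sum_{i,j}\mathbf{Q}_{ij}^2$; $\|\cdot\|$ of a vector is the Euclidean norm; $\mathbf{1}\in\mathbb{R}^n$ is the all-ones vector. For $s\in\{1,\dots,n\}$ and $B>0$, $$\Xi(s,B)=\Big\{\boldsymbol{\mu}\in\mathbb{R}^n: |\mathrm{supp}(\boldsymbol{\mu})|=s,\ \min_{i\in\mathrm{supp}(\boldsymbol{\mu})}\mu_i\ge B\Big\},\qquad \mathrm{supp}(\boldsymbol{\mu})=\{1\le i\le n:\mu_i\neq0\}.$$ A test is a function $T:\{\pm1\}^n\to\{0,1\}$,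 where the value $1$ means rejecting $H_0$. Its worst-case risk is $$\mathrm{Risk}(T)=\mathbb{P}_{\mathbf{Q},\mathbf{0}}(T(\mathbf{X})=1)+\sup_{\boldsymbol{\mu}\in\Xi(s,B)}\mathbb{P}_{\mathbf{Q},\boldsymbol{\mu}}(T(\mathbf{X})=0).$$ A sequence of tests (indexed by $n$) is asymptotically powerful if $\limsup_{n\to\infty}\mathrm{Risk}(T)=0$. All asymptotics are as $n\to\infty$. *)

(* Defs.v *)
From HB Require Import structures.
From mathcomp Require Import all_boot all_order all_algebra.
From mathcomp Require Import all_classical all_reals all_analysis.
Import Order.TTheory GRing.Theory Num.Theory.
Import numFieldNormedType.Exports.

Set Implicit Arguments.
Unset Strict Implicit.
Unset Printing Implicit Defensive.

Local Open Scope classical_set_scope.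
Local Open Scope ring_scope.

Definition tanh (R : realType) (x : R) : R :=
  (expR x - expR (- x)) / (expR x + expR (- x)).

(* The hypercube {-1,1}^n is indexed by Boolean functions through
   false |-> 1, true |-> -1; [spin x] is the actual vector of signs. *)
Definition config (n : nat) := {ffun 'I_n -> bool}.

Definition spin (R : realType) (n : nat) (x : config n) : 'cV[R]_n :=
  \col_i (-1) ^+ x i.

Section Ising.
Variables (R : realType) (n : nat) (Q : 'M[R]_n) (mu : 'cV[R]_n).

Definition ising_weight (x : config n) : R :=
  expR (2^-1 * ((spin R x)^T *m Q *m spin R x) 0 0 + (mu^T *m spin R x) 0 0).

Definition ising_Z : R := \sum_(x : config n) ising_weight x.

Definition ising_pmf (x : config n) : R := ising_weight x / ising_Z.

Definition ising_prob (A : pred (config n)) : R := \sum_(x | A x) ising_pmf x.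

Lemma ising_weight_gt0 x : 0 < ising_weight x.
Proof. exact: expR_gt0. Qed.

Lemma ising_Z_gt0 : 0 < ising_Z.
Proof.
rewrite /ising_Z (bigD1 [ffun=> false]) //=.
by rewrite ltr_pwDl ?ising_weight_gt0 // sumr_ge0 // => x _; exact/ltW/ising_weight_gt0.
Qed.

Lemma ising_pmf_ge0 x : 0 <= ising_pmf x.
Proof. by rewrite divr_ge0 // ltW ?ising_weight_gt0 ?ising_Z_gt0. Qed.

Lemma ising_probT : ising_prob xpredT = 1.
Proof. by rewrite /ising_prob -mulr_suml divff // gt_eqF ?ising_Z_gt0. Qed.

Lemma ising_prob_le1 A : ising_prob A <= 1.
Proof.
rewrite -ising_probT /ising_prob [leRHS](bigID A) /= lerDl.
by rewrite sumr_ge0 // => x _; exact: ising_pmf_ge0.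
Qed.
End Ising.

(* [`|x|] is the max-norm on matrices, hence the l_infty norm on columns. *)
Definition opnorm_infty (R : realType) (n : nat) (Q : 'M[R]_n) : R :=
  sup [set `|Q *m x| | x in [set x : 'cV[R]_n | `|x| <= 1]].

Definition frobenius_norm (R : realType) (n : nat) (Q : 'M[R]_n) : R :=
  Num.sqrt (\sum_(i < n) \sum_(j < n) Q i j ^+ 2).

(* Needed because the library norm of a vector is the max-norm. *)
Definition euclidean_norm (R : realType) (n : nat) (v : 'cV[R]_n) : R :=
  Num.sqrt (\sum_(i < n) v i 0 ^+ 2).

Definition ones (R : realType) (n : nat) : 'cV[R]_n := const_mx 1.

Definition vsupp (R : realType) (n : nat) (mu : 'cV[R]_n) : {set 'I_n} :=
  [set i | mu i 0 != 0]%SET.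

Definition Xi (R : realType) (n s : nat) (B : R) : set 'cV[R]_n :=
  [set mu | #|vsupp mu| = s /\ forall i, i \in vsupp mu -> B <= mu i 0].

Definition test (n : nat) := config n -> bool.

Definition risk (R : realType) (n : nat) (Q : 'M[R]_n) (s : nat) (B : R)
    (T : test n) : R :=
  ising_prob Q 0 (fun x => T x) +
  sup [set ising_prob Q mu (fun x => ~~ T x) | mu in @Xi R n s B].

Definition asymptotically_powerful (R : realType) (Q : forall n, 'M[R]_n)
    (s : nat -> nat) (B : nat -> R) (T : forall n, test n) : Prop :=
  limn_esup (fun n => (risk (Q n) (s n) (B n) (T n))%:E) = 0%E.

Lemma opnorm_inftyE (R : realType) (n : nat) (Q : 'M[R]_n) :
  opnorm_infty Q = \big[Num.max/(0 : R)]_(i < n) \sum_(j < n) `|Q i j|.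
Proof.
set M := RHS.
have M0 : 0 <= M by exact: bigmax_ge_id.
have nE (v : 'cV[R]_n) : `|v| = \big[Num.max/(0 : R)]_ij `|v ij.1 ij.2|.
  by rewrite [LHS]/Num.Def.normr/= mx_normrE.
have ub (x : 'cV[R]_n) : `|x| <= 1 -> `|Q *m x| <= M.
  move=> x1; rewrite nE; apply: bigmax_le => // -[i k] _ /=.
  apply: le_trans (le_bigmax _ (fun i => \sum_(j < n) `|Q i j|) i).
  rewrite mxE (le_trans (ler_norm_sum _ _ _))// ler_sum// => j _.
  rewrite normrM ler_piMr//; apply: le_trans x1; rewrite nE.
  exact: (le_bigmax _ (fun ij => `|x ij.1 ij.2|) (j, k)).
have hub : has_ubound [set `|Q *m x| | x in [set x : 'cV[R]_n | `|x| <= 1]].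
  by exists M => _ [x x1 <-]; exact: ub.
apply/eqP; rewrite eq_le; apply/andP; split.
  apply: ge_sup; last by move=> _ [x x1 <-]; exact: ub.
  by exists `|Q *m (0 : 'cV[R]_n)|, 0 => //=; rewrite normr0.
apply: bigmax_le.
  apply: ub_le_sup => //; exists 0; rewrite /= ?normr0//.
  by rewrite mulmx0 normr0.
move=> i _; pose x : 'cV[R]_n := \col_j Num.sg (Q i j).
have x1 : `|x| <= 1.
  rewrite nE; apply: bigmax_le => // -[j k] _ /=; rewrite mxE normr_sg.
  by case: (_ == _).
apply: (@le_trans _ _ `|Q *m x|); last by apply: ub_le_sup => //; exists x.
rewrite nE.
apply: le_trans (le_bigmax _ (fun ij => `|(Q *m x) ij.1 ij.2|) (i, 0)) => /=.
rewrite mxE; apply: le_trans (ler_norm _); apply: ler_sum => j _.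
by rewrite mxE normrEsg mulrC.
Qed.

Lemma has_sup_risk (R : realType) (n : nat) (Q : 'M[R]_n) (s : nat) (B : R)
    (T : test n) : (s <= n)%N -> 0 < B ->
  has_sup [set ising_prob Q mu (fun x => ~~ T x) | mu in @Xi R n s B].
Proof.
move=> sn B0; split; last by exists 1 => _ [mu _ <-]; exact: ising_prob_le1.
apply: image_nonempty; exists (\col_i if (i < s)%N then B else 0).
have suppE i : (i \in vsupp (\col_(i < n) if (i < s)%N then B else 0)) = (i < s)%N.
  by rewrite inE mxE; case: ifP; rewrite ?eqxx ?gt_eqF.
split=> [|i]; last by rewrite suppE mxE => ->.
rewrite (eq_card (B := mem [set widen_ord sn j | j : 'I_s]%SET)) => [|i].
  rewrite card_imset ?card_ord // => j k /(congr1 val) /= jk; exact/val_inj.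
rewrite suppE; apply/idP/imsetP => [i_s|[j _ ->]] //=.
by exists (Ordinal i_s) => //; apply/val_inj.
Qed.

(* Main.v *)
Require Import Defs.
From mathcomp Require Import all_boot all_order all_algebra.
From mathcomp Require Import all_classical all_reals all_analysis.
From mathcomp Require Import ring lra.
Import Order.TTheory GRing.Theory Num.Theory.
Import numFieldNormedType.Exports.
Local Open Scope classical_set_scope.
Local Open Scope ring_scope.

Set Implicit Arguments.
Unset Strict Implicit.
Unset Printing Implicit Defensive.

(** The risk of a test against a mixture of alternatives is bounded below as soon
    as the likelihood ratio L of the mixture has bounded second moment under the
    null.  The prior splits the sites into s blocks of size m = n / s and puts the
    field B on one independent uniform site per block.  For two such sets S, S',
    the second moment is the average of
      Z(mu_S + mu_S') Z(0) / (Z(mu_S) Z(mu_S')),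
    which telescopes, adding one site of S and one of S' at a time; with
    t = tanh B, each step costs at most a factor 1 + t^2 Cov_nu(x_i, x_j) for an
    Ising model with some nonnegative field nu.  By FKG and the contraction
    property of tanh,
      Cov_nu(x_i, x_j) <= delta_ij + sum_k Q_ik Cov_nu(x_k, x_j)
    for every field nu, so that Cov_nu <= M := (I - Q)^-1 entrywise, and the rows
    and columns of M sum to at most K := 1 / (1 - rho).  Averaging
    exp(t^2 sum_(S x S') M) over the independent blocks of S' gives at most
    exp(e^K K t^2 s / m), which is bounded because (s t)^2 <= C^2 n. *)

(** * FKG inequality *)

Section FKG.
Variables (R : realType) (n : nat).
Implicit Types (x y : config n) (k : 'I_n) (l : seq 'I_n) (f g w : config n -> R).

Definition upd x k (b : bool) : config n := [ffun i => if i == k then b else x i].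

(* The order is reversed on Booleans because [true] encodes the spin -1. *)
Definition spin_le x y := forall i, y i -> x i.

Definition spin_mono f := forall x y, spin_le x y -> f x <= f y.

(** The FKG lattice condition, one coordinate at a time: the ratio of the weights with spin [k] up
    and down increases with the other spins. *)
Definition log_supermodular w := forall k x y, spin_le x y ->
  w (upd x k false) * w (upd y k true) <= w (upd x k true) * w (upd y k false).

(** Coordinates outside [l] stay frozen at those of [x]; the recursion allows induction on the free
    spins. *)
Fixpoint cube_sum l f x : R :=
  if l is k :: l' then cube_sum l' f (upd x k false) + cube_sum l' f (upd x k true)
  else f x.

Lemma upd_upd x k a b : upd (upd x k a) k b = upd x k b.
Proof. by apply/ffunP => i; rewrite !ffunE; case: eqP. Qed.

Lemma updC x k j a b : k != j -> upd (upd x k a) j b = upd (upd x j b) k a.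
Proof.
move=> kj; apply/ffunP => i; rewrite !ffunE.
by case: (eqVneq i j) => // ->; rewrite eq_sym (negbTE kj).
Qed.

Lemma upd_id x k : upd x k (x k) = x.
Proof. by apply/ffunP => i; rewrite !ffunE; case: eqP => // ->. Qed.

Lemma spin_le_upd x y k b : spin_le x y -> spin_le (upd x k b) (upd y k b).
Proof. by move=> xy i; rewrite !ffunE; case: eqP => // _; exact: xy. Qed.

Lemma spin_le_flip x k : spin_le (upd x k true) (upd x k false).
Proof. by move=> i; rewrite !ffunE; case: eqP. Qed.

Lemma cube_sum_upd l f x k b : k \notin l ->
  cube_sum l f (upd x k b) = cube_sum l (fun y => f (upd y k b)) x.
Proof.
elim: l x => //= j l IH x; rewrite inE negb_or => /andP[kj kl].
by rewrite !(updC _ _ _ kj) !IH.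
Qed.

Lemma cube_sumE l f x : uniq l ->
  cube_sum l f x = \sum_(y : config n | [forall i, (i \notin l) ==> (y i == x i)]) f y.
Proof.
elim: l x => [|k l IH] x /=.
  move=> _; rewrite (big_pred1 x) // => y; apply/forallP/eqP => [xy|->] //.
  by apply/ffunP => i; apply/eqP; exact: xy.
move=> /andP[kl ul]; rewrite !IH // [RHS](bigID (fun y : config n => y k)) /= [RHS]addrC.
congr (_ + _); apply: eq_bigl => y.
  apply/forallP/andP => [H|[/forallP H yk] i].
    split; last by have := H k; rewrite kl ffunE eqxx => /= /eqP ->.
    apply/forallP => i; apply/implyP; rewrite inE negb_or => /andP[ik il].
    by have := H i; rewrite il ffunE (negbTE ik).
  apply/implyP => il; rewrite ffunE; case: (eqVneq i k) => [->|ik].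
    by rewrite (negbTE yk).
  by have := H i; rewrite inE negb_or ik il.
apply/forallP/andP => [H|[/forallP H yk] i].
  split; last by have := H k; rewrite kl ffunE eqxx => /= /eqP ->.
  apply/forallP => i; apply/implyP; rewrite inE negb_or => /andP[ik il].
  by have := H i; rewrite il ffunE (negbTE ik).
apply/implyP => il; rewrite ffunE; case: (eqVneq i k) => [->|ik].
  by rewrite yk.
by have := H i; rewrite inE negb_or ik il.
Qed.

Lemma cube_sumT f x : cube_sum (enum 'I_n) f x = \sum_y f y.
Proof.
rewrite cube_sumE ?enum_uniq //; apply: eq_bigl => y.
by apply/forallP => i; rewrite mem_enum.
Qed.

Lemma le_cube_sum l f g x : (forall y, f y <= g y) -> cube_sum l f x <= cube_sum l g x.
Proof. by move=> fg; elim: l x => //= k l IH x; rewrite lerD. Qed.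

Lemma cube_sum_gt0 l f x : (forall y, 0 < f y) -> 0 < cube_sum l f x.
Proof. by move=> f0; elim: l x => //= k l IH x; rewrite addr_gt0. Qed.

Lemma eq_cube_sum l f g x : f =1 g -> cube_sum l f x = cube_sum l g x.
Proof. by move=> fg; elim: l x => //= k l IH x; rewrite !IH. Qed.

Lemma log_supermodular_upd w k b :
  log_supermodular w -> log_supermodular (fun x => w (upd x k b)).
Proof.
move=> sw j x y xy; case: (eqVneq j k) => [->|jk]; first by rewrite !upd_upd.
by rewrite !(updC _ _ _ jk); apply: sw; exact: spin_le_upd.
Qed.

Lemma spin_mono_upd f k b : spin_mono f -> spin_mono (fun x => f (upd x k b)).
Proof. by move=> mf x y xy; apply: mf; exact: spin_le_upd. Qed.

(* Mixture step of FKG: up/down averages that are correlated in each half and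
   ordered between the halves are correlated overall. *)
Lemma correlation_mixture (W1 W2 F1 F2 G1 G2 H1 H2 : R) : 0 < W1 -> 0 < W2 ->
  F1 * G1 <= W1 * H1 -> F2 * G2 <= W2 * H2 ->
  F2 * W1 <= F1 * W2 -> G2 * W1 <= G1 * W2 ->
  (F1 + F2) * (G1 + G2) <= (W1 + W2) * (H1 + H2).
Proof.
move=> W10 W20 c1 c2 f21 g21.
have W0 : 0 < W1 * W2 by rewrite mulr_gt0.
have d1 : W2 ^+ 2 * (F1 * G1) <= W2 ^+ 2 * (W1 * H1) by rewrite ler_wpM2l ?sqr_ge0.
have d2 : W1 ^+ 2 * (F2 * G2) <= W1 ^+ 2 * (W2 * H2) by rewrite ler_wpM2l ?sqr_ge0.
have e1 : W1 * W2 * (F1 * G1) <= W1 * W2 * (W1 * H1).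
  by apply: ler_wpM2l => //; exact: ltW.
have e2 : W1 * W2 * (F2 * G2) <= W1 * W2 * (W2 * H2).
  by apply: ler_wpM2l => //; exact: ltW.
have p : 0 <= (F1 * W2 - F2 * W1) * (G1 * W2 - G2 * W1) by rewrite mulr_ge0 ?subr_ge0.
(* Multiplied by [W1 * W2], the claim is the sum of [d1], [d2], [e1], [e2] and [p]. *)
rewrite -(ler_pM2l W0); lra.
Qed.

(** Induction on the free spins: each half, with spin [k] up or down, is correlated by induction,
    [step] orders the averages of the halves, and [correlation_mixture] combines them. *)
Lemma FKG_cube l w f g x : uniq l -> (forall y, 0 < w y) -> log_supermodular w ->
  spin_mono f -> spin_mono g ->
  cube_sum l (w \* f) x * cube_sum l (w \* g) x <=
  cube_sum l w x * cube_sum l (fun y => w y * f y * g y) x.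
Proof.
elim: l w f g x => [|k l IH] w f g x /=.
  by move=> _ _ _ _ _; rewrite le_eqVlt; apply/orP; left; apply/eqP; ring.
move=> /andP[kl ul] w0 sw mf mg.
(* The increasing ratio [r] turns the down measure [wt] into the up measure. Induction correlates
   [r] with [h], and turning spin [k] up only increases [h]. *)
have step h : spin_mono h -> cube_sum l (w \* h) (upd x k true) *
    cube_sum l w (upd x k false) <=
    cube_sum l (w \* h) (upd x k false) * cube_sum l w (upd x k true).
  move=> mh; rewrite !cube_sum_upd //.
  pose wt y := w (upd y k true).
  pose r y := w (upd y k false) / wt y.
  have wr y : wt y * r y = w (upd y k false).
    by rewrite /r mulrC divfK ?gt_eqF ?w0.
  have mr : spin_mono r.
    move=> y z yz; rewrite /r ler_pdivrMr ?w0 // mulrAC ler_pdivlMr ?w0 //.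
    by rewrite [leRHS]mulrC; exact: sw.
  have := IH wt (fun y => h (upd y k false)) r x ul (fun y => w0 _)
    (log_supermodular_upd k true sw) (spin_mono_upd k false mh) mr.
  rewrite (@eq_cube_sum _ (wt \* r) (fun y => w (upd y k false))) //.
  rewrite (@eq_cube_sum _ (fun y => wt y * h (upd y k false) * r y)
    (fun y => (w \* h) (upd y k false))) => [|y]; last by rewrite /= -wr; ring.
  rewrite [leRHS]mulrC => /(le_trans _); apply.
  apply: ler_wpM2r; first by apply/ltW/cube_sum_gt0 => y; exact: w0.
  apply: le_cube_sum => y /=; apply: ler_wpM2l; first exact/ltW.
  exact/mh/spin_le_flip.
apply: correlation_mixture; [exact: cube_sum_gt0|exact: cube_sum_gt0|
  exact: IH|exact: IH|exact: step|exact: step].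
Qed.

Lemma FKG w f g : (forall y, 0 < w y) -> log_supermodular w ->
  spin_mono f -> spin_mono g ->
  (\sum_x w x * f x) * (\sum_x w x * g x) <=
  (\sum_x w x) * (\sum_x w x * f x * g x).
Proof.
move=> w0 sw mf mg; have := FKG_cube [ffun=> false] (enum_uniq 'I_n) w0 sw mf mg.
by rewrite !cube_sumT.
Qed.
End FKG.

(** * Contraction property of tanh *)

Lemma is_derive_tanh (R : realType) (x : R) :
  is_derive x 1 (@tanh R) (4 / (expR x + expR (- x)) ^+ 2).
Proof.
have c0 : expR x + expR (- x) != 0 by rewrite gt_eqF ?addr_gt0 ?expR_gt0.
have dN : is_derive x 1 (fun y : R => expR (- y)) (- expR (- x)).
  rewrite -[X in is_derive _ _ _ X]mulrN1.
  exact: (is_derive1_comp (f := expR) (g := -%R)).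
have dc : is_derive x 1 (fun y : R => expR y + expR (- y)) (expR x - expR (- x)).
  exact: is_deriveD.
have ds : is_derive x 1 (fun y : R => expR y - expR (- y)) (expR x + expR (- x)).
  by rewrite -[X in _ + X]opprK; exact: is_deriveB.
have dV : is_derive x 1 (fun y : R => (expR y + expR (- y))^-1)
    (- (expR x + expR (- x)) ^- 2 *: (expR x - expR (- x))).
  case: dc => dc1 dc2; apply: DeriveDef; first exact: derivableV.
  by rewrite deriveV // dc2.
apply: is_derive_eq (is_deriveM ds dV) _.
rewrite /GRing.scale /= expRN; move: c0; rewrite expRN.
have := expR_gt0 x; move: (expR x) => a a0 c0; field.
by rewrite (gt_eqF a0) /= gt_eqF // ltr_pwDr // mulr_ge0 // ltW.
Qed.

(** Mean value theorem: the derivative is 1 / cosh^2, which is at most 1. *)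
Lemma tanh_contraction (R : realType) (a b : R) : a <= b -> tanh b - tanh a <= b - a.
Proof.
move=> ab; have dt (x : R) := is_derive_tanh x.
have [|c _ ->] := MVT_segment ab (fun x _ => dt x).
  by apply: derivable_within_continuous => x _; case: (dt x).
rewrite ler_piMl ?subr_ge0 // ler_pdivrMr ?exprn_gt0 ?addr_gt0 ?expR_gt0 // mul1r.
have := expRxMexpNx_1 c; have := sqr_ge0 (expR c - expR (- c)); nra.
Qed.

(** * Covariances of Ising spins *)

Section IsingCovariance.
Variables (R : realType) (n : nat) (Q : 'M[R]_n).
Hypothesis Q_sym : Q^T = Q.
Hypothesis Q_hollow : forall i, Q i i = 0.
Hypothesis Q_ge0 : forall i j, 0 <= Q i j.
Implicit Types (mu : 'cV[R]_n) (x y : config n) (i j k : 'I_n) (f g : config n -> R).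

Definition sgn x i : R := (-1) ^+ x i.

(** The field felt by spin [k] given the others; a hollow [Q] makes it independent of [x k]. *)
Definition local_field mu k x : R := mu k 0 + \sum_j Q k j * sgn x j.

Lemma sgn_mono i : spin_mono (sgn ^~ i).
Proof.
move=> x y /(_ i); rewrite /sgn; case: (x i) (y i) => [] [] //= yx.
- by rewrite expr1 expr0; lra.
- by have := yx isT.
Qed.

Lemma sgn_upd x k b i : sgn (upd x k b) i = if i == k then (-1) ^+ b else sgn x i.
Proof. by rewrite /sgn ffunE; case: eqP. Qed.

Lemma local_field_mono mu k : spin_mono (local_field mu k).
Proof.
move=> x y xy; rewrite lerD2l ler_sum // => j _.
by rewrite ler_wpM2l // sgn_mono.
Qed.

Lemma local_field_upd mu k x b : local_field mu k (upd x k b) = local_field mu k x.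
Proof.
congr (_ + _); apply: eq_bigr => j _; rewrite sgn_upd.
by case: eqP => // ->; rewrite Q_hollow !mul0r.
Qed.

(** With the other spins fixed the exponent is affine in spin [k], because [Q] has zero diagonal;
    [c] collects the terms free of that spin. *)
Lemma ising_weight_upd mu k x : exists2 c, 0 < c &
  forall b, ising_weight Q mu (upd x k b) = c * expR ((-1) ^+ b * local_field mu k x).
Proof.
pose v : 'cV[R]_n := \col_i if i == k then 0 else sgn x i.
exists (expR (2^-1 * (v^T *m Q *m v) 0 0 + (mu^T *m v) 0 0)) => [|b].
  exact: expR_gt0.
pose e : 'cV[R]_n := delta_mx k 0.
have -> : ising_weight Q mu (upd x k b) =
    expR (2^-1 * ((v + (-1) ^+ b *: e)^T *m Q *m (v + (-1) ^+ b *: e)) 0 0 +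
      (mu^T *m (v + (-1) ^+ b *: e)) 0 0).
  have -> // : v + (-1) ^+ b *: e = spin R (upd x k b).
  apply/matrixP => i j; rewrite !mxE ffunE (ord1 j) eqxx andbT /sgn.
  by case: eqP => _; rewrite ?add0r ?mulr1 // mulr0 addr0.
rewrite -expRD; congr expR.
have hE : local_field mu k x = mu k 0 + (Q *m v) k 0.
  rewrite mxE; congr (_ + _); apply: eq_bigr => j _; rewrite mxE.
  by case: eqP => // ->; rewrite Q_hollow !mul0r.
have e1 : (e^T *m Q *m v) 0 0 = (Q *m v) k 0.
  by rewrite /e trmx_delta -mulmxA -rowE mxE.
have e2 : (v^T *m Q *m e) 0 0 = (Q *m v) k 0.
  by rewrite -colE mxE -{1}Q_sym -trmx_mul mxE.
have e3 : (e^T *m Q *m e) 0 0 = 0.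
  by rewrite -colE mxE /e trmx_delta -rowE mxE.
have e4 : (mu^T *m e) 0 0 = mu k 0 by rewrite -colE !mxE.
have addE (A A' : 'M[R]_1) : (A + A') 0 0 = A 0 0 + A' 0 0 by rewrite mxE.
have scaleE a (A : 'M[R]_1) : (a *: A) 0 0 = a * A 0 0 by rewrite mxE.
rewrite [(v + _)^T]linearD /= [((-1) ^+ b *: e)^T]linearZ /= !mulmxDl !mulmxDr.
rewrite -!scalemxAr -!scalemxAl -?scalemxAr.
rewrite !(addE, scaleE) e1 e2 e3 e4 hE; by field.
Qed.

(** The log-ratio of the weights with spin [k] up and down is twice the local field, which is
    increasing since [Q] is nonnegative. *)
Lemma ising_pmf_supermodular mu : log_supermodular (ising_pmf Q mu).
Proof.
move=> k x y xy; rewrite /ising_pmf !(mulrACA _ (ising_Z Q mu)^-1).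
apply: ler_wpM2r; first by rewrite mulr_ge0 // invr_ge0 ltW ?ising_Z_gt0.
have [c c0 cE] := ising_weight_upd mu k x; have [d d0 dE] := ising_weight_upd mu k y.
rewrite !(cE, dE) !(mulrACA _ (expR _)) -!expRD.
apply: ler_wpM2l; [by rewrite mulr_ge0 // ltW|rewrite ler_expR].
have := local_field_mono mu k xy; rewrite !expr0 !expr1; lra.
Qed.

Definition mean mu f : R := \sum_x ising_pmf Q mu x * f x.

Definition cov mu f g : R := mean mu (f \* g) - mean mu f * mean mu g.

Lemma ising_pmf_gt0 mu x : 0 < ising_pmf Q mu x.
Proof. by rewrite divr_gt0 ?ising_weight_gt0 ?ising_Z_gt0. Qed.

Lemma sum_ising_pmf mu : \sum_x ising_pmf Q mu x = 1.
Proof. exact: (ising_probT Q mu). Qed.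

Lemma cov_ge0 mu f g : spin_mono f -> spin_mono g -> 0 <= cov mu f g.
Proof.
move=> mf mg; rewrite subr_ge0.
apply: le_trans (FKG (ising_pmf_gt0 mu) (ising_pmf_supermodular mu) mf mg) _.
by rewrite sum_ising_pmf mul1r; apply: ler_sum => x _; rewrite -mulrA.
Qed.

Lemma sum_pair_upd k f :
  \sum_x f x = \sum_(x : config n | x k) (f (upd x k false) + f (upd x k true)).
Proof.
rewrite (bigID (fun x : config n => x k)) /= addrC big_split /=; congr (_ + _).
  rewrite (reindex_onto (fun x => upd x k false) (fun x => upd x k true)) /=.
    apply: eq_bigl => x; rewrite ffunE eqxx upd_upd /=.
    by apply/eqP/idP => [<-|xk]; rewrite ?ffunE ?eqxx // -{2}(upd_id x k) xk.
  by move=> x /negbTE xk; rewrite upd_upd -{2}(upd_id x k) xk.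
by apply: eq_bigr => x xk; rewrite -{1}(upd_id x k) xk.
Qed.

(** Given the other spins, up and down have weights proportional to exp(h) and exp(-h), h being the
    local field, so both sides agree on each pair of configurations differing at [k]. *)
Lemma mean_sgn_tanh mu k g : (forall x b, g (upd x k b) = g x) ->
  mean mu (fun x => sgn x k * g x) = mean mu (fun x => tanh (local_field mu k x) * g x).
Proof.
move=> gk; apply/eqP; rewrite -subr_eq0 /mean -sumrB (sum_pair_upd k).
apply/eqP/big1 => x _; rewrite !gk !local_field_upd !sgn_upd eqxx expr0 expr1.
rewrite /ising_pmf; have [c c0 cE] := ising_weight_upd mu k x.
rewrite !cE expr0 expr1 mulN1r mul1r /tanh.
set h := local_field mu k x.
have : expR h + expR (- h) != 0 by rewrite gt_eqF ?addr_gt0 ?expR_gt0.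
have := lt0r_neq0 (ising_Z_gt0 Q mu).
by move=> Z0 c1; field; apply/andP.
Qed.

End IsingCovariance.
Arguments sgn R {n} x i.

Section Mean.
Variables (R : realType) (n : nat) (Q : 'M[R]_n).
Implicit Types (mu nu : 'cV[R]_n) (x : config n) (i j k : 'I_n) (f g : config n -> R).

Lemma eq_mean mu f g : f =1 g -> mean Q mu f = mean Q mu g.
Proof. by move=> fg; apply: eq_bigr => x _; rewrite fg. Qed.

Lemma meanD mu f g : mean Q mu (fun x => f x + g x) = mean Q mu f + mean Q mu g.
Proof. by rewrite -big_split; apply: eq_bigr => x _; rewrite mulrDr. Qed.

Lemma meanZ mu a f : mean Q mu (fun x => a * f x) = a * mean Q mu f.
Proof. by rewrite mulr_sumr; apply: eq_bigr => x _; rewrite mulrCA. Qed.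

Lemma mean_sum mu (I : finType) (F : I -> config n -> R) :
  mean Q mu (fun x => \sum_i F i x) = \sum_i mean Q mu (F i).
Proof. by rewrite exchange_big; apply: eq_bigr => x _; rewrite mulr_sumr. Qed.

Lemma mean_cst mu a : mean Q mu (fun=> a) = a.
Proof. by rewrite /mean -mulr_suml sum_ising_pmf mul1r. Qed.

Lemma ising_weightD mu nu x :
  ising_weight Q (mu + nu) x = ising_weight Q mu x * expR ((nu^T *m spin R x) 0 0).
Proof.
rewrite /ising_weight -expRD [(mu + nu)^T]linearD /= mulmxDl.
by rewrite [(mu^T *m _ + _) 0 0]mxE addrA.
Qed.

Lemma mean_tilt mu nu f :
  ising_Z Q (mu + nu) * mean Q (mu + nu) f =
  ising_Z Q mu * mean Q mu (fun x => expR ((nu^T *m spin R x) 0 0) * f x).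
Proof.
rewrite /mean !mulr_sumr; apply: eq_bigr => x _.
have Z0 mu' : ising_Z Q mu' != 0 by rewrite gt_eqF ?ising_Z_gt0.
rewrite /ising_pmf ising_weightD; by field; rewrite !Z0.
Qed.

Lemma ising_Z_tilt mu nu : ising_Z Q (mu + nu) =
  ising_Z Q mu * mean Q mu (fun x => expR ((nu^T *m spin R x) 0 0)).
Proof.
rewrite -[LHS]mulr1 -(mean_cst (mu + nu) 1) mean_tilt; congr (_ * _).
by apply: eq_mean => x; rewrite mulr1.
Qed.

(** The global spin flip preserves the zero-field law and changes the sign of every spin. *)
Lemma mean_sgn_zero_field i : mean Q 0 (sgn R ^~ i) = 0.
Proof.
pose neg x : config n := [ffun j => ~~ x j].
have negK : involutive neg by move=> x; apply/ffunP => j; rewrite !ffunE negbK.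
have spin_neg x : spin R (neg x) = - spin R x.
  by apply/matrixP => j k; rewrite !mxE ffunE; case: (x j); rewrite ?opprK.
have pmf_neg x : ising_pmf Q 0 (neg x) = ising_pmf Q 0 x.
  rewrite /ising_pmf /ising_weight spin_neg trmx0 !mul0mx.
  by rewrite [(- _)^T]linearN /= !(mulNmx, mulmxN) opprK.
suff : mean Q 0 (sgn R ^~ i) = - mean Q 0 (sgn R ^~ i) by lra.
rewrite {1}/mean (reindex_inj (inv_inj negK)) -sumrN.
apply: eq_bigr => x _; rewrite pmf_neg -mulrN /sgn ffunE.
by case: (x i); rewrite ?opprK.
Qed.
End Mean.

(** * Resolvent of the interaction matrix *)

Section Resolvent.
Variables (R : realType) (n : nat) (Q : 'M[R]_n) (rho : R).
Hypothesis Q_sym : Q^T = Q.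
Hypothesis Q_ge0 : forall i j, 0 <= Q i j.
Hypothesis Q_row : forall i, \sum_j Q i j <= rho.
Hypothesis rho_lt1 : rho < 1.

(** Maximum principle: a positive maximum [v m] would satisfy [v m <= rho * v m] with [rho < 1]. *)
Lemma subsolution_le0 (v : 'I_n -> R) :
  (forall i, v i <= \sum_j Q i j * v j) -> forall i, v i <= 0.
Proof.
move=> vQ i0.
pose m := [arg max_(i > i0) v i]%O.
have vm i : v i <= v m by rewrite /m; case: arg_maxP => // k _; exact.
apply: le_trans (vm i0) _; rewrite leNgt; apply/negP => m0.
have : v m <= rho * v m.
  apply: le_trans (vQ m) _; apply: (@le_trans _ _ (\sum_j Q m j * v m)).
    by apply: ler_sum => j _; rewrite ler_wpM2l.
  by rewrite -mulr_suml; apply: ler_wpM2r => //; exact: ltW.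
by apply/negP; rewrite -ltNge gtr_pMl.
Qed.

Definition resolvent := invmx (1%:M - Q).

(** A kernel vector satisfies v = Q v, so v and -v are both subsolutions and v vanishes. *)
Lemma resolvent_unit : 1%:M - Q \in unitmx.
Proof.
rewrite unitmxE unitfE; apply/det0P => -[v v0]; rewrite mulmxBr mulmx1 => /eqP.
rewrite subr_eq0 => /eqP vQ; case/eqP: v0.
have vE i : v 0 i = \sum_j Q i j * v 0 j.
  by rewrite {1}vQ mxE; apply: eq_bigr => j _; rewrite -{1}Q_sym mxE mulrC.
apply/rowP => i; rewrite mxE; apply: le_anti.
rewrite (subsolution_le0 (v := fun i => v 0 i)) => [|k]; last by rewrite -vE.
rewrite -oppr_le0 (subsolution_le0 (v := fun i => - v 0 i)) // => k.
by rewrite {1}vE -sumrN; under eq_bigr do rewrite -mulrN.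
Qed.

Lemma resolventE i j : resolvent i j = (i == j)%:R + \sum_k Q i k * resolvent k j.
Proof.
have /matrixP/(_ i j) := mulmxV resolvent_unit.
by rewrite mulmxBl mul1mx !mxE => /eqP; rewrite subr_eq => /eqP.
Qed.

Lemma resolvent_sym i j : resolvent i j = resolvent j i.
Proof.
have : resolvent^T = resolvent by rewrite trmx_inv linearB /= trmx1 Q_sym.
by move=> /matrixP/(_ j i); rewrite mxE.
Qed.

(** Comparison principle: by [resolventE], [c] minus column [j] of the resolvent is a
    subsolution. *)
Lemma le_resolvent (c : 'I_n -> R) j :
  (forall i, c i <= (i == j)%:R + \sum_k Q i k * c k) ->
  forall i, c i <= resolvent i j.
Proof.
move=> cQ i; rewrite -subr_le0.
apply: (subsolution_le0 (v := fun i => c i - resolvent i j)) => k.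
under eq_bigr do rewrite mulrBr.
by rewrite sumrB resolventE; have := cQ k; lra.
Qed.

Lemma resolvent_ge0 i j : 0 <= resolvent i j.
Proof.
apply: (le_resolvent (c := fun=> 0)) => k.
by rewrite big1 ?addr0 ?ler0n // => l _; rewrite mulr0.
Qed.

(** The constant r = 1 / (1 - rho) solves r = 1 + rho r, so the row sums minus r form a
    subsolution. *)
Lemma resolvent_row i : \sum_j resolvent i j <= (1 - rho)^-1.
Proof.
rewrite -subr_le0.
apply: (subsolution_le0 (v := fun i => \sum_j resolvent i j - (1 - rho)^-1)) => k.
under [leRHS]eq_bigr do rewrite mulrBr mulr_sumr.
rewrite sumrB exchange_big -mulr_suml /=.
have -> : \sum_j resolvent k j = 1 + \sum_j \sum_l Q k l * resolvent l j.
  under eq_bigr do rewrite resolventE.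
  rewrite big_split /= (bigD1 k) //= eqxx big1 ?addr0 // => j.
  by rewrite eq_sym => /negbTE ->.
have r0 : 0 < 1 - rho by rewrite subr_gt0.
have : (\sum_j Q k j) * (1 - rho)^-1 <= rho * (1 - rho)^-1.
  by rewrite ler_wpM2r // invr_ge0 ltW.
have : (1 - rho) * (1 - rho)^-1 = 1 by rewrite divff // gt_eqF.
lra.
Qed.

Lemma resolvent_col j : \sum_i resolvent i j <= (1 - rho)^-1.
Proof. by under eq_bigr do rewrite resolvent_sym; exact: resolvent_row. Qed.
End Resolvent.

(** * Domination of covariances by the resolvent *)

Section CovarianceBound.
Variables (R : realType) (n : nat) (Q : 'M[R]_n) (rho : R).
Hypothesis Q_sym : Q^T = Q.
Hypothesis Q_hollow : forall i, Q i i = 0.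
Hypothesis Q_ge0 : forall i j, 0 <= Q i j.
Hypothesis Q_row : forall i, \sum_j Q i j <= rho.
Hypothesis rho_lt1 : rho < 1.
Implicit Types (mu nu : 'cV[R]_n) (x : config n) (i j k : 'I_n) (l : seq 'I_n).

Let M := resolvent Q.

(** The tilt by a nonnegative field is an increasing function, so FKG at zero field correlates it
    with spin [i], whose zero-field mean is 0. *)
Lemma mean_sgn_ge0 mu i : (forall j, 0 <= mu j 0) -> 0 <= mean Q mu (sgn R ^~ i).
Proof.
move=> mu0; have := mean_tilt Q 0 mu (sgn R ^~ i); rewrite add0r => E.
rewrite -(pmulr_rge0 _ (ising_Z_gt0 Q mu)) E.
apply: mulr_ge0; first exact/ltW/ising_Z_gt0.
have mg : spin_mono (fun x : config n => expR ((mu^T *m spin R x) 0 0)).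
  move=> x y xy; rewrite ler_expR !mxE ler_sum // => j _; rewrite !mxE.
  by apply: ler_wpM2l => //; exact: sgn_mono.
have := cov_ge0 Q_sym Q_hollow Q_ge0 0 mg (sgn_mono R i).
by rewrite /cov mean_sgn_zero_field mulr0 subr0.
Qed.

(* Conditionally on the other spins, the mean of spin i is the tanh of its local
   field, and local field minus tanh is increasing, so FKG lets one drop the tanh. *)
Lemma cov_sgn_recursion mu i j :
  cov Q mu (sgn R ^~ i) (sgn R ^~ j) <=
  (i == j)%:R + \sum_k Q i k * cov Q mu (sgn R ^~ k) (sgn R ^~ j).
Proof.
(* On the diagonal the variance is at most 1 and the remaining sum is nonnegative by FKG. *)
case: (eqVneq i j) => [->|ij].
  have : cov Q mu (sgn R ^~ j) (sgn R ^~ j) <= 1.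
    rewrite /cov (@eq_mean _ _ _ _ _ (fun=> 1)) => [|x]; last first.
      by rewrite /= /sgn -expr2 sqrr_sign.
    by rewrite mean_cst gerBl -expr2 sqr_ge0.
  move=> /le_trans; apply; rewrite lerDl sumr_ge0 // => k _; rewrite mulr_ge0 //.
  exact (cov_ge0 Q_sym Q_hollow Q_ge0 mu (sgn_mono R k) (sgn_mono R j)).
rewrite add0r.
pose h := local_field Q mu i; pose th x := tanh (h x).
have mono : spin_mono (fun x => h x - th x).
  move=> x y xy; have := tanh_contraction (local_field_mono Q_ge0 mu i xy).
  by rewrite /th /h; lra.
have := cov_ge0 Q_sym Q_hollow Q_ge0 mu mono (sgn_mono R j).
have thE g : (forall x b, g (upd x i b) = g x) ->
    mean Q mu (fun x => th x * g x) = mean Q mu (fun x => sgn R x i * g x).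
  by move=> gi; rewrite mean_sgn_tanh.
have hE g : mean Q mu (fun x => h x * g x) =
    mu i 0 * mean Q mu g + \sum_k Q i k * mean Q mu (fun x => sgn R x k * g x).
  under eq_bigr do rewrite -meanZ.
  rewrite -mean_sum -meanZ -meanD; apply: eq_mean => x.
  by rewrite mulrDl mulr_suml; congr (_ + _); apply: eq_bigr => k _; rewrite mulrA.
(* Valid for [g] free of spin [i]; it serves for spin [j] with j different from i and for the
   constant 1, and the [mu i 0] terms then cancel in the covariance. *)
have diffE g : (forall x b, g (upd x i b) = g x) ->
    mean Q mu (fun x => (h x - th x) * g x) = mu i 0 * mean Q mu g +
    \sum_k Q i k * mean Q mu (fun x => sgn R x k * g x) -
    mean Q mu (fun x => sgn R x i * g x).
  move=> gi; rewrite -thE // -hE -mulN1r -meanZ -meanD.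
  by apply: eq_mean => x; rewrite mulrBl mulN1r.
rewrite {1}/cov (diffE (sgn R ^~ j)) => [|x b]; last first.
  by rewrite sgn_upd eq_sym (negbTE ij).
have := diffE (fun=> 1) (fun _ _ => erefl).
have mul1 (f : config n -> R) : mean Q mu (fun x => f x * 1) = mean Q mu f.
  by apply: eq_mean => x; rewrite mulr1.
have -> : \sum_k Q i k * mean Q mu (fun x => sgn R x k * 1) =
    \sum_k Q i k * mean Q mu (sgn R ^~ k).
  by apply: eq_bigr => k _; rewrite mul1.
rewrite mean_cst !mul1 => ->; rewrite /cov.
under [X in _ -> _ <= X]eq_bigr do rewrite mulrBr mulrA.
rewrite sumrB -mulr_suml /GRing.mul_fun /=; lra.
Qed.

Lemma cov_sgn_le mu i j : cov Q mu (sgn R ^~ i) (sgn R ^~ j) <= M i j.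
Proof.
apply: (le_resolvent Q_sym Q_ge0 Q_row rho_lt1
  (c := fun i => cov Q mu (sgn R ^~ i) (sgn R ^~ j))) => k.
exact: cov_sgn_recursion.
Qed.

End CovarianceBound.

(** * Ratios of partition functions *)

Section PartitionFunction.
Variables (R : realType) (n : nat) (Q : 'M[R]_n) (rho B : R).
Hypothesis Q_sym : Q^T = Q.
Hypothesis Q_hollow : forall i, Q i i = 0.
Hypothesis Q_ge0 : forall i j, 0 <= Q i j.
Hypothesis Q_row : forall i, \sum_j Q i j <= rho.
Hypothesis rho_lt1 : rho < 1.
Hypothesis B_gt0 : 0 < B.
Implicit Types (mu nu : 'cV[R]_n) (x : config n) (i j k : 'I_n) (l : seq 'I_n).

Let M := resolvent Q.
Let t := tanh B.
Let Z := ising_Z Q.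

Definition site_field i : 'cV[R]_n := B *: delta_mx i 0.

Definition list_field l : 'cV[R]_n := \sum_(i <- l) site_field i.

Lemma tanh_ge0 : 0 <= t.
Proof.
apply: divr_ge0; last by rewrite addr_ge0 ?expR_ge0.
by rewrite subr_ge0 ler_expR; have := B_gt0; lra.
Qed.

Lemma site_field_ge0 i j : 0 <= site_field i j 0.
Proof. by rewrite !mxE mulr_ge0 ?ler0n // ltW. Qed.

Lemma list_field_ge0 l i : 0 <= list_field l i 0.
Proof. by rewrite summxE sumr_ge0 // => j _; exact: site_field_ge0. Qed.

Lemma list_field_cons i l : list_field (i :: l) = site_field i + list_field l.
Proof. exact: big_cons. Qed.

(** A spin takes two values, so the exponential tilt is affine in it; ratios of partition functions
    thereby become means and covariances of spins. *)
Lemma expR_site_field i x : expR (((site_field i)^T *m spin R x) 0 0) =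
  (expR B + expR (- B)) / 2 * (1 + t * sgn R x i).
Proof.
rewrite /site_field linearZ /= -scalemxAl trmx_delta -rowE !mxE.
have c0 : expR B + expR (- B) != 0 by rewrite gt_eqF ?addr_gt0 ?expR_gt0.
by rewrite /t /tanh /sgn; case: (x i); rewrite ?expr1 ?expr0 ?mulrN1 ?mulr1; field.
Qed.

Lemma ising_Z_site_pair mu i j : (forall k, 0 <= mu k 0) ->
  Z (site_field i + (site_field j + mu)) * Z mu <=
  expR (t ^+ 2 * M i j) * (Z (site_field i + mu) * Z (site_field j + mu)).
Proof.
move=> mu0; rewrite addrA !(addrC _ mu) /Z.
set c := (expR B + expR (- B)) / 2.
have c0 : 0 < c by rewrite divr_gt0 ?addr_gt0 ?expR_gt0.
pose m k := mean Q mu (sgn R ^~ k).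
have m0 k : 0 <= m k by exact: mean_sgn_ge0.
have Z1 k : ising_Z Q (mu + site_field k) = ising_Z Q mu * (c * (1 + t * m k)).
  rewrite ising_Z_tilt; congr (_ * _).
  under eq_mean do rewrite expR_site_field.
  by rewrite meanZ meanD mean_cst meanZ.
have Z2 : ising_Z Q (mu + (site_field i + site_field j)) = ising_Z Q mu *
    (c ^+ 2 * (1 + t * m i + t * m j +
      t ^+ 2 * (cov Q mu (sgn R ^~ i) (sgn R ^~ j) + m i * m j))).
  rewrite ising_Z_tilt /cov subrK -/(m i) -/(m j); congr (_ * _).
  rewrite -!meanZ -(mean_cst Q mu 1) -!meanD -meanZ; apply: eq_mean => x.
  rewrite [(_ + _)^T]linearD /= mulmxDl mxE expRD !expR_site_field -/c.
  by rewrite /GRing.mul_fun; ring.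
have W0 : 0 < ising_Z Q mu := ising_Z_gt0 Q mu.
have t0 := tanh_ge0.
rewrite Z2 !Z1.
have a1 k : 1 <= 1 + t * m k by rewrite lerDl mulr_ge0.
have M0 : 0 <= M i j := resolvent_ge0 Q_sym Q_ge0 Q_row rho_lt1 i j.
have covM : cov Q mu (sgn R ^~ i) (sgn R ^~ j) <= M i j.
  exact: (cov_sgn_le Q_sym Q_hollow Q_ge0 Q_row rho_lt1).
set P := (1 + t * m i) * (1 + t * m j).
have P1 : 1 <= P by rewrite mulr_ege1.
have S0 : 0 <= t ^+ 2 * M i j by rewrite mulr_ge0 // sqr_ge0.
(* Without the covariance the left side is [P]. As [P] is at least 1, the extra term t^2 M is at
   most t^2 M P. *)
have key : 1 + t * m i + t * m j +
    t ^+ 2 * (cov Q mu (sgn R ^~ i) (sgn R ^~ j) + m i * m j) <=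
    expR (t ^+ 2 * M i j) * P.
  apply: (@le_trans _ _ ((1 + t ^+ 2 * M i j) * P)); last first.
    by apply: ler_wpM2r; [lra|exact: expR_ge1Dx].
  have : t ^+ 2 * cov Q mu (sgn R ^~ i) (sgn R ^~ j) <= t ^+ 2 * M i j.
    by apply: ler_wpM2l => //; exact: sqr_ge0.
  have : t ^+ 2 * M i j <= t ^+ 2 * M i j * P by rewrite ler_peMr.
  rewrite /P; lra.
have : (ising_Z Q mu * c) ^+ 2 * (1 + t * m i + t * m j +
    t ^+ 2 * (cov Q mu (sgn R ^~ i) (sgn R ^~ j) + m i * m j)) <=
    (ising_Z Q mu * c) ^+ 2 * (expR (t ^+ 2 * M i j) * P).
  by apply: ler_wpM2l => //; exact: sqr_ge0.
by rewrite /P; congr (_ <= _); ring.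
Qed.

(** Chains a/d <= p c/b and c/b <= q f/e, with denominators cleared. *)
Lemma ratio_bound_trans (a b c d e f p q : R) : 0 < b -> 0 <= p -> 0 <= d -> 0 <= e ->
  a * b <= p * (d * c) -> c * e <= q * (b * f) -> a * e <= p * q * (d * f).
Proof.
move=> b0 p0 d0 e0 h1 h2; rewrite -(ler_pM2l b0).
have := ler_wpM2r e0 h1; have := ler_wpM2l (mulr_ge0 p0 d0) h2; lra.
Qed.

(** Each new site [j] of the list is paired with [i] in the background [list_field l + mu], which
    stays nonnegative. *)
Lemma ising_Z_site_list mu i l : (forall k, 0 <= mu k 0) ->
  Z (site_field i + (list_field l + mu)) * Z mu <=
  expR (t ^+ 2 * \sum_(j <- l) M i j) * (Z (site_field i + mu) * Z (list_field l + mu)).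
Proof.
move=> mu0; elim: l => [|j l IH].
  by rewrite /list_field !big_nil mulr0 expR0 mul1r add0r.
rewrite list_field_cons big_cons mulrDr expRD -addrA [Z (site_field i + mu) * _]mulrC.
apply: (@ratio_bound_trans _ (Z (list_field l + mu))
  (Z (site_field i + (list_field l + mu)))).
- exact: ising_Z_gt0.
- exact: expR_ge0.
- exact/ltW/ising_Z_gt0.
- exact/ltW/ising_Z_gt0.
- rewrite [X in _ <= _ * X]mulrC; apply: ising_Z_site_pair => k.
  by rewrite mxE addr_ge0 ?list_field_ge0.
- by rewrite [Z (list_field l + mu) * _]mulrC.
Qed.

(** Sites of [l] enter one at a time, each against all of [l'], with the earlier sites of [l] as
    background field. *)
Lemma ising_Z_list l l' : Z (list_field l + list_field l') * Z 0 <=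
  expR (t ^+ 2 * \sum_(i <- l) \sum_(j <- l') M i j) *
  (Z (list_field l) * Z (list_field l')).
Proof.
elim: l => [|i l IH].
  by rewrite /list_field !big_nil mulr0 expR0 mul1r add0r mulrC.
rewrite list_field_cons big_cons mulrDr expRD -addrA.
apply: (@ratio_bound_trans _ (Z (list_field l)) (Z (list_field l + list_field l'))).
- exact: ising_Z_gt0.
- exact: expR_ge0.
- exact/ltW/ising_Z_gt0.
- exact/ltW/ising_Z_gt0.
- rewrite [list_field l + _]addrC; apply: ising_Z_site_list => k.
  exact: list_field_ge0.
- exact: IH.
Qed.
End PartitionFunction.

(** * Second moment and testing error *)

Section Testing.
Variables (R : realType) (n : nat) (Q : 'M[R]_n).
Variables (I : finType) (mu : I -> 'cV[R]_n) (L : R).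
Hypothesis I_gt0 : (0 < #|I|)%N.
Hypothesis L_gt0 : 0 < L.
Implicit Types (x : config n).

(** The log-weight is affine in the field, so the weights at nu + nu' and 0 multiply to the product
    of those at nu and nu'. *)
Lemma ising_pmf_chi2 (nu nu' : 'cV[R]_n) :
  \sum_x ising_pmf Q nu x * ising_pmf Q nu' x / ising_pmf Q 0 x =
  ising_Z Q (nu + nu') * ising_Z Q 0 / (ising_Z Q nu * ising_Z Q nu').
Proof.
rewrite -mulrA [in RHS]/ising_Z mulr_suml -/(ising_Z Q 0) -/(ising_Z Q nu).
rewrite -/(ising_Z Q nu'); apply: eq_bigr => x _.
have Z0 v : ising_Z Q v != 0 by rewrite gt_eqF ?ising_Z_gt0.
have w0 : ising_weight Q 0 x != 0 by rewrite gt_eqF ?ising_weight_gt0.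
have E : ising_weight Q (nu + nu') x * ising_weight Q 0 x =
    ising_weight Q nu x * ising_weight Q nu' x.
  by rewrite ising_weightD -[nu' in RHS]add0r ising_weightD; ring.
rewrite /ising_pmf -[ising_weight Q (nu + nu') x](mulfK w0) E.
by field; rewrite w0 !Z0.
Qed.

(* Pointwise AM-GM, [p <= p^2 / (2 L p0) + L p0 / 2], with p the mixture density. *)
Lemma mixture_test_error (A : pred (config n)) :
  \sum_i \sum_j ising_Z Q (mu i + mu j) * ising_Z Q 0 /
    (ising_Z Q (mu i) * ising_Z Q (mu j)) <= L * #|I|%:R ^+ 2 ->
  2^-1 <= L / 2 * ising_prob Q 0 A +
    (\sum_i ising_prob Q (mu i) (predC A)) / #|I|%:R.
Proof.
move=> HL; set N : R := #|I|%:R.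
have N0 : 0 < N by rewrite ltr0n.
pose p x := (\sum_i ising_pmf Q (mu i) x) / N.
have sump : \sum_x p x = 1.
  rewrite -mulr_suml exchange_big /=.
  under eq_bigr do rewrite sum_ising_pmf.
  by rewrite sumr_const divff // gt_eqF.
have -> : (\sum_i ising_prob Q (mu i) (predC A)) / N = 1 - \sum_(x | A x) p x.
  rewrite -sump [X in _ = X - _](bigID A) /= [X in _ = X - _]addrC addrK.
  by rewrite /ising_prob exchange_big /= mulr_suml.
suff : \sum_(x | A x) p x <= 2^-1 + L / 2 * ising_prob Q 0 A by lra.
have amgm x : p x <= p x ^+ 2 / ising_pmf Q 0 x / (2 * L) + L / 2 * ising_pmf Q 0 x.
  have q0 := ising_pmf_gt0 Q 0 x; move: (ising_pmf Q 0 x) q0 => q q0.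
  rewrite -subr_ge0.
  have -> : p x ^+ 2 / q / (2 * L) + L / 2 * q - p x = (p x - L * q) ^+ 2 / (2 * L * q).
    by field; rewrite !gt_eqF.
  by rewrite divr_ge0 ?sqr_ge0 // !mulr_ge0 // ltW.
apply: le_trans (ler_sum _ (fun x _ => amgm x)) _.
rewrite big_split /= -mulr_sumr lerD2r.
have sq0 x : 0 <= p x ^+ 2 / ising_pmf Q 0 x / (2 * L).
  apply: divr_ge0; last by rewrite mulr_ge0 // ltW.
  by apply: divr_ge0; [exact: sqr_ge0|exact: ising_pmf_ge0].
apply: (@le_trans _ _ (\sum_x p x ^+ 2 / ising_pmf Q 0 x / (2 * L))).
  by rewrite [leRHS](bigID A) /= lerDl sumr_ge0.
rewrite -mulr_suml.
have -> : \sum_x p x ^+ 2 / ising_pmf Q 0 x = (\sum_i \sum_j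
    ising_Z Q (mu i + mu j) * ising_Z Q 0 / (ising_Z Q (mu i) * ising_Z Q (mu j)))
    / N ^+ 2.
  under [in RHS]eq_bigr do under eq_bigr do rewrite -ising_pmf_chi2.
  under [in RHS]eq_bigr do rewrite exchange_big /=.
  rewrite exchange_big /= mulr_suml; apply: eq_bigr => x _.
  have -> : \sum_i \sum_j ising_pmf Q (mu i) x * ising_pmf Q (mu j) x / ising_pmf Q 0 x =
      (\sum_i ising_pmf Q (mu i) x) ^+ 2 / ising_pmf Q 0 x.
    rewrite expr2 !mulr_suml; apply: eq_bigr => i _.
    by rewrite mulr_sumr mulr_suml.
  by rewrite /p expr_div_n mulrAC.
rewrite ler_pdivrMr ?mulr_gt0 // ler_pdivrMr ?exprn_gt0 //.
by apply: le_trans HL _; rewrite [2^-1 * _]mulrA mulVf ?mul1r // pnatr_eq0.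
Qed.
End Testing.

(** * Exponential moment of the block prior *)

Section BlockMoment.
Variables (R : realType) (n s m : nat) (M : 'I_n -> 'I_n -> R) (K tau : R).
Variable site : 'I_s -> 'I_m -> 'I_n.
Hypothesis site_inj : forall b c b' c', site b c = site b' c' -> b = b' /\ c = c'.
Hypothesis M_ge0 : forall i j, 0 <= M i j.
Hypothesis M_row : forall i, \sum_j M i j <= K.
Hypothesis M_col : forall j, \sum_i M i j <= K.
Hypothesis m_gt0 : (0 < m)%N.
Hypothesis tau_ge0 : 0 <= tau.
Hypothesis tau_le1 : tau <= 1.

Lemma le_sum_inj (J : finType) (h : J -> 'I_n) (F : 'I_n -> R) :
  injective h -> (forall i, 0 <= F i) -> \sum_b F (h b) <= \sum_i F i.
Proof.
move=> hi F0; rewrite -(big_imset F (h := h) (A := predT)) /=; last first.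
  by move=> b c _ _; exact: hi.
by rewrite [leRHS](bigID (mem (h @: predT)%SET)) /= lerDl sumr_ge0.
Qed.

(** Multiplying 1 - y <= exp(-y) by exp(y) gives exp(y) <= 1 + y exp(y). *)
Lemma expR_le_chord (y : R) : 0 <= y <= K -> expR y <= 1 + expR K * y.
Proof.
move=> /andP[y0 yK].
have := ler_wpM2l (expR_ge0 y) (expR_ge1Dx (- y)).
rewrite expRxMexpNx_1.
have : expR y * y <= expR K * y by rewrite ler_wpM2r // ler_expR.
lra.
Qed.

(** For fixed [f] the exponent is a sum over the blocks of [g], so the sum over [g] factorizes.
    Column sums keep each exponent within the range of [expR_le_chord]. *)
Lemma block_exp_moment (f : {ffun 'I_s -> 'I_m}) :
  \sum_(g : {ffun 'I_s -> 'I_m})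
    expR (tau * \sum_b \sum_b' M (site b (f b)) (site b' (g b'))) <=
  #|{ffun 'I_s -> 'I_m}|%:R * expR (expR K * K * (tau * s%:R / m%:R)).
Proof.
have mR : 0 < m%:R :> R by rewrite ltr0n.
pose a b' c : R := \sum_b M (site b (f b)) (site b' c).
have a0 b' c : 0 <= a b' c by exact: sumr_ge0.
have aK b' c : a b' c <= K.
  apply: le_trans (M_col (site b' c)).
  apply: (@le_sum_inj _ (fun b => site b (f b)) (fun i => M i (site b' c))) => // b d.
  by case/site_inj.
have -> : \sum_(g : {ffun 'I_s -> 'I_m})
    expR (tau * \sum_b \sum_b' M (site b (f b)) (site b' (g b'))) =
    \prod_b' \sum_c expR (tau * a b' c).
  rewrite bigA_distr_bigA; apply: eq_bigr => g _.
  by rewrite exchange_big /= mulr_sumr expR_sum.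
have blk b' : \sum_c expR (tau * a b' c) <=
    m%:R * expR (expR K * tau / m%:R * \sum_c a b' c).
  apply: (@le_trans _ _ (m%:R * (1 + expR K * tau / m%:R * \sum_c a b' c))).
    have -> : m%:R * (1 + expR K * tau / m%:R * \sum_c a b' c) =
        \sum_(c < m) (1 + expR K * (tau * a b' c)).
      rewrite big_split /= sumr_const card_ord -!mulr_sumr.
      by field; rewrite gt_eqF.
    apply: ler_sum => c _; apply: expR_le_chord; rewrite mulr_ge0 //=.
    by apply: le_trans (aK b' c); rewrite ler_piMl.
  by rewrite ler_pM2l // expR_ge1Dx.
apply: (@le_trans _ _ (\prod_(b' < s)
    (m%:R * expR (expR K * tau / m%:R * \sum_c a b' c)))).
  apply: ler_prod => b' _; rewrite blk andbT; apply: sumr_ge0 => c _; exact: expR_ge0.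
rewrite big_split /= prodr_const -expR_sum -mulr_sumr card_ffun !card_ord natrX.
rewrite ler_wpM2l ?exprn_ge0 ?ler0n // ler_expR.
(* Each of the s sites chosen by [f] meets every site at most once, contributing at most one row
   sum. *)
have sumA : \sum_b' \sum_c a b' c <= s%:R * K.
  rewrite /a; under eq_bigr do rewrite exchange_big /=.
  rewrite exchange_big /= -[s in leRHS]card_ord mulr_natl -sumr_const.
  apply: ler_sum => b _; apply: le_trans (M_row (site b (f b))).
  rewrite pair_bigA /=.
  apply: (@le_sum_inj _ (fun bc => site bc.1 bc.2) (fun j => M (site b (f b)) j)) => //.
  by move=> [b1 c1] [b2 c2] /= /site_inj[-> ->].
have -> : expR K * K * (tau * s%:R / m%:R) = expR K * tau / m%:R * (s%:R * K).
  by field; rewrite gt_eqF.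
by rewrite ler_wpM2l // !mulr_ge0 ?expR_ge0 // invr_ge0 ltW.
Qed.
End BlockMoment.

(** * Lower bound on the risk *)

Lemma tanh_le1 (R : realType) (x : R) : tanh x <= 1.
Proof.
rewrite ler_pdivrMr ?addr_gt0 ?expR_gt0 // mul1r.
by have := expR_gt0 (- x); lra.
Qed.

Lemma row_sum_le_opnorm (R : realType) (n : nat) (Q : 'M[R]_n) (i : 'I_n) :
  \sum_j Q i j <= opnorm_infty Q.
Proof.
rewrite opnorm_inftyE.
apply: le_trans (le_bigmax _ (fun i => \sum_j `|Q i j|) i).
by apply: ler_sum => j _; exact: ler_norm.
Qed.

Lemma list_field_Xi (R : realType) (n s : nat) (B : R) (h : 'I_s -> 'I_n) :
  0 < B -> injective h -> list_field B [seq h b | b <- enum 'I_s] \in @Xi R n s B.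
Proof.
move=> B0 hi; set mu := list_field _ _.
have muE i : mu i 0 = \sum_b B * (i == h b)%:R.
  rewrite /mu /list_field big_map big_enum /= summxE; apply: eq_bigr => b _.
  by rewrite !mxE andbT.
have mu_h b : mu (h b) 0 = B.
  rewrite muE (bigD1 b) //= eqxx mulr1 big1 ?addr0 // => c cb.
  by rewrite (inj_eq hi) eq_sym (negbTE cb) mulr0.
have mu_out i : i \notin codom h -> mu i 0 = 0.
  move=> hN; rewrite muE big1 // => b _; case: eqP => [ib|_]; last by rewrite mulr0.
  by rewrite ib codom_f in hN.
have suppE : vsupp mu = [set h b | b in 'I_s]%SET.
  apply/setP => i; rewrite inE; apply/idP/imsetP => [|[b _ ->]]; last first.
    by rewrite mu_h gt_eqF.
  apply: contra_neqP => hN; apply: mu_out; apply/negP => /codomP[b ib].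
  by apply: hN; exists b.
rewrite inE /Xi /= suppE card_imset // card_ord; split=> // _ /imsetP[b _ ->].
by rewrite mu_h.
Qed.

Lemma risk_lower_bound (R : realType) (n s : nat) (Q : 'M[R]_n) (B rho C : R)
    (T : test n) :
  (0 < s <= n)%N -> 0 < B -> Q^T = Q -> (forall i, Q i i = 0) ->
  (forall i j, 0 <= Q i j) -> (forall i, \sum_j Q i j <= rho) -> rho < 1 ->
  s%:R * tanh B <= C * Num.sqrt n%:R ->
  (2 * expR (expR (1 - rho)^-1 * (1 - rho)^-1 * (2 * C ^+ 2)))^-1 <= risk Q s B T.
Proof.
move=> /andP[s0 sn] B0 Qs Qh Q0 Qr r1 sB; set K := (1 - rho)^-1.
pose m := (n %/ s)%N.
have m0 : (0 < m)%N by rewrite divn_gt0.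
have smn : (s * m <= n)%N by rewrite mulnC leq_divM.
(* The blocks are the rows of an s by m array filling the first s m indices; leftover sites carry no
   field. *)
pose site (b : 'I_s) (c : 'I_m) : 'I_n := widen_ord smn (mxvec_index b c).
have site_inj b c b' c' : site b c = site b' c' -> b = b' /\ c = c'.
  by move=> /(congr1 val) /= /val_inj /enum_rank_inj [-> ->].
pose I := {ffun 'I_s -> 'I_m}.
pose l (f : I) := [seq site b (f b) | b <- enum 'I_s].
pose mu (f : I) := list_field B (l f).
have I0 : (0 < #|I|)%N by rewrite card_ffun !card_ord expn_gt0 m0.
have t0 : 0 <= tanh B := tanh_ge0 B0.
have t1 := tanh_le1 B.
have K0 : 0 < K by rewrite invr_gt0 subr_gt0.
(* [E0] bounds the second moment. Doubling it ensures L >= 2, so 1/2 <= (L/2) P0 + S, with P0 the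
   type I error, gives a risk of at least 1/L. *)
set E0 := expR (_ * (2 * C ^+ 2)); pose L := 2 * E0.
have E1 : 1 <= E0.
  rewrite /E0 -expR0 ler_expR; apply: mulr_ge0.
    by rewrite mulr_ge0 ?expR_ge0 // ltW.
  by rewrite mulr_ge0 // sqr_ge0.
have L0 : 0 < L by rewrite /L; lra.
have mR : 0 < m%:R :> R by rewrite ltr0n.
have expo : expR K * K * (tanh B ^+ 2 * s%:R / m%:R) <= expR K * K * (2 * C ^+ 2).
  apply: ler_wpM2l; first by rewrite mulr_ge0 ?expR_ge0 // ltW.
  rewrite ler_pdivrMr //.
  have nR : 0 < n%:R :> R by rewrite ltr0n; exact: leq_trans sn.
  (* The factor 2 comes from n < (m + 1) s and m >= 1. *)
  have n2 : n%:R <= 2 * (s%:R * m%:R) :> R.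
    rewrite -!natrM ler_nat; have := ltn_ceil n s0; rewrite -/m mulSn => nlt.
    apply: leq_trans (ltnW nlt) _; rewrite mul2n -addnn mulnC leq_add2r.
    by rewrite leq_pmulr.
  have sB2 : (s%:R * tanh B) ^+ 2 <= C ^+ 2 * n%:R.
    rewrite -[n%:R in leRHS]sqr_sqrtr ?ler0n // -exprMn lerXn2r //.
      by rewrite nnegrE mulr_ge0.
    by rewrite nnegrE; apply: le_trans sB; rewrite mulr_ge0.
  rewrite -(ler_pM2r nR).
  have := ler_wpM2l (mulr_ge0 (sqr_ge0 (tanh B)) (ler0n R s)) n2.
  have := ler_wpM2r (ltW mR) sB2; lra.
have second : \sum_f \sum_g ising_Z Q (mu f + mu g) * ising_Z Q 0 /
    (ising_Z Q (mu f) * ising_Z Q (mu g)) <= L * #|I|%:R ^+ 2.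
  apply: (@le_trans _ _ (\sum_(f : I) #|I|%:R * E0)); last first.
    by rewrite sumr_const -[X in X <= _]mulr_natr /L; have := ler0n R #|I|; nra.
  apply: ler_sum => f _.
  apply: le_trans (_ : _ <= #|I|%:R * expR (expR K * K * (tanh B ^+ 2 * s%:R / m%:R))) _.
    apply: le_trans (block_exp_moment site_inj
      (resolvent_ge0 Qs Q0 Qr r1) (resolvent_row Qs Q0 Qr r1)
      (resolvent_col Qs Q0 Qr r1) m0 (sqr_ge0 _) _ f); last by rewrite expr_le1.
    apply: ler_sum => g _.
    rewrite ler_pdivrMr ?mulr_gt0 ?ising_Z_gt0 //.
    apply: le_trans (ising_Z_list Qs Qh Q0 Qr r1 B0 (l f) (l g)) _.
    rewrite big_map big_enum /=.
    by under eq_bigr do rewrite big_map big_enum /=.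
  by rewrite ler_wpM2l ?ler0n // ler_expR.
have := mixture_test_error I0 L0 T second.
set S := sup [set ising_prob Q mu (fun x => ~~ T x) | mu in @Xi R n s B].
have avg : (\sum_f ising_prob Q (mu f) (predC T)) / #|I|%:R <= S.
  rewrite ler_pdivrMr ?ltr0n // mulr_natr -sumr_const; apply: ler_sum => f _.
  apply: ub_le_sup; first by case: (has_sup_risk Q T sn B0).
  exists (mu f) => //; apply: set_mem; apply: list_field_Xi => // b c.
  by case/site_inj.
have S0 : 0 <= S.
  apply: le_trans avg; rewrite divr_ge0 ?ler0n // sumr_ge0 // => f _.
  by rewrite sumr_ge0 // => x _; exact: ising_pmf_ge0.
rewrite -/L /risk -/S => H.
rewrite -[X in X <= _]mul1r ler_pdivrMr //.
have L2 : 2 <= L by rewrite /L; lra.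
have : 2 * S <= L * S by rewrite ler_wpM2r.
move: H avg; rewrite /ising_prob; nra.
Qed.

Theorem theorem6 (R : realType) (Q : forall n : nat, 'M[R]_n)
    (s : nat -> nat) (B : nat -> R) (rho C : R)
    (s_range : forall n : nat, (0 < n)%N -> (1 <= s n <= n)%N)
    (B_gt0 : forall n : nat, (0 < n)%N -> 0 < B n)
    (Q_sym : forall n : nat, (Q n)^T = Q n)
    (Q_hollow : forall (n : nat) (i : 'I_n), Q n i i = 0)
    (Q_ge0 : forall (n : nat) (i j : 'I_n), 0 <= Q n i j)
    (rho_gt0 : 0 < rho) (rho_lt1 : rho < 1)
    (Q_opnorm : forall n : nat, opnorm_infty (Q n) <= rho)
    (Q_frobenius :
      (fun n : nat => frobenius_norm (Q n) ^+ 2)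
        =O_\oo (fun n : nat => Num.sqrt (n%:R : R)))
    (Q_regular :
      (fun n : nat => euclidean_norm
         (Q n *m ones R n
          - (((ones R n)^T *m Q n *m ones R n) 0 0 / n%:R) *: ones R n) ^+ 2)
        =O_\oo (fun _ : nat => 1 : R))
    (C_gt0 : 0 < C)
    (signal_bound : forall n : nat, (0 < n)%N ->
      (s n)%:R * tanh (B n) <= C * Num.sqrt n%:R) :
  ~ exists T : forall n : nat, test n, asymptotically_powerful Q s B T.
Proof.
case=> T; rewrite /asymptotically_powerful => limT.
pose K := (1 - rho)^-1; pose c := (2 * expR (expR K * K * (2 * C ^+ 2)))^-1.
have c0 : 0 < c by rewrite invr_gt0 mulr_gt0 ?expR_gt0.
have riskT n : (0 < n)%N -> c <= risk (Q n) (s n) (B n) (T n).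
  move=> n0; apply: risk_lower_bound; [exact: s_range|exact: B_gt0|exact: Q_sym|
    exact: Q_hollow|exact: Q_ge0| |exact: rho_lt1|exact: signal_bound].
  by move=> i; exact: le_trans (row_sum_le_opnorm _ i) (Q_opnorm n).
have : (c%:E <= limn_esup (fun n => (risk (Q n) (s n) (B n) (T n))%:E))%E.
  apply: le_ereal_inf_tmp => _ [V [N _ NV] <-].
  (* The index is [N.+1] rather than [N] because [riskT] requires a positive n. *)
  apply: ereal_sup_ge; exists (risk (Q N.+1) (s N.+1) (B N.+1) (T N.+1))%:E.
    by exists N.+1 => //; apply: NV => /=.
  by rewrite lee_fin riskT.
by rewrite limT lee_fin leNgt c0.
Qed.
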